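(* For every $\theta\in[0,2\pi)$, the fermionic nonlinearity of the two-qubit unitary channels $\mathcal{C}(\theta)(\cdot)=C(\theta)(\cdot)C(\theta)^\dagger$, $\mathcal{R}_{ZZ}(\theta)(\cdot)=R_{ZZ}(\theta)(\cdot)R_{ZZ}(\theta)^\dagger$ and $\mathcal{SWAP}(\cdot)=\mathrm{SWAP}(\cdot)\mathrm{SWAP}^\dagger$ equals the unitary extent of the respective gate: $$\Phi(\mathcal{C}(\theta))=1+\left|\sin\tfrac\theta2\right|,\qquad \Phi(\mathcal{R}_{ZZ}(\theta))=1+|\sin\theta|,\qquad \Phi(\mathcal{SWAP})=2 .$$
   Context: $C(\theta)=\mathrm{diag}(1,1,1,e^{i\theta})$, $R_{ZZ}(\theta)=e^{-i\theta Z\otimes Z/2}$, and $\mathrm{SWAP}$ exchanges the two qubits. On $n$ qubits let $c_{2j-1}=Z^{\otimes(j-1)}\otimes X\otimes I^{\otimes(n-j)}$ and $c_{2j}=Z^{\otimes(j-1)}\otimes Y\otimes I^{\otimes(n-j)}$, $j=1,\dots,n$. The set $G_n$ of Gaussian unitaries consists of the $n$-qubit unitaries $V$ for which there is $R\in O(2n)$ with $Vc_jV^\dagger=\sum_kR_{j,k}c_k$ for all $j$. The unitary extent is $\xi(U)=\min\{\|c\|_1^2:U=\sum_jc_jK_j,\ K_j\in G_n,\ c_j\in\mathbb{C}\}$. The fermionic nonlinearity of an $n$-qubit channel is $\Phi(\mathcal{E})=\min\{\|q\|_1:\mathcal{E}(\cdot)=\sum_jq_jL_j(\cdot)R_j,\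 L_j,R_j\in G_n,\ q_j\in\mathbb{R}\}$. Here $n=2$. *)

(* Defs.v *)
From HB Require Import structures.
From mathcomp Require Import all_boot all_order all_algebra.
From mathcomp Require Import all_classical all_reals all_analysis.
From mathcomp.real_closed Require Import complex.
(* not imported: its notation [A ^t k] clashes with the one of [spectral] *)
From mathcomp.real_closed Require mxtens.

Set Implicit Arguments.
Unset Strict Implicit.
Unset Printing Implicit Defensive.

Import Order.TTheory GRing.Theory Num.Theory numFieldNormedType.Exports.

Local Open Scope ring_scope.
Local Open Scope complex_scope.
Local Open Scope classical_set_scope.
Local Open Scope sesquilinear_scope.

(* Kronecker product, first factor most significant: the basis vector
   |x, y> has index [x * n + y]. *)
Notation "A *t B" := (mxtens.tensmx A B)
  (at level 40, left associativity) : ring_scope.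

Section Gates.
Context {R : realType}.
Local Notation C := R[i].

Definition expi (t : R) : C := cos t +i* sin t.

(* The sum of the exponential series [\sum_k A ^+ k / k`!], the limit being
   taken separately on the real and imaginary part of each entry. *)
Definition expmx_partial {m : nat} (A : 'M[C]_m) (N : nat) : 'M[C]_m :=
  \sum_(0 <= k < N) (k`!%:R)^-1 *: A ^+ k.

Definition expmx {m : nat} (A : 'M[C]_m) : 'M[C]_m :=
  \matrix_(i, j)
    (limn (fun N => complex.Re (expmx_partial A N i j)) +i*
     limn (fun N => complex.Im (expmx_partial A N i j))).

Definition pauliX : 'M[C]_2 := \matrix_(i, j) (i != j)%:R.
Definition pauliY : 'M[C]_2 :=
  \matrix_(i, j) (if i == j then 0 else if (i < j)%N then - 'i else 'i).
Definition pauliZ : 'M[C]_2 := \matrix_(i, j) ((i == j)%:R * (-1) ^+ i).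

(* [tensor_string n P] is [P 0 *t P 1 *t ... *t P n.-1]. *)
Fixpoint tensor_string (n : nat) : (nat -> 'M[C]_2) -> 'M[C]_(2 ^ n) :=
  match n with
  | 0 => fun=> 1%:M
  | n'.+1 =>
    match n' return ((nat -> 'M[C]_2) -> 'M[C]_(2 ^ n')) ->
                    (nat -> 'M[C]_2) -> 'M[C]_(2 ^ n'.+1) with
    | 0 => fun _ P => P 0%N
    | _.+1 => fun rec P => P 0%N *t rec (fun k => P k.+1)
    end (tensor_string n')
  end.

(* Indices start from 0: [majorana n (2 * j)] and [majorana n (2 * j + 1)] are
   the operators usually written c_(2j+1) and c_(2j+2). *)
Definition majorana (n k : nat) : 'M[C]_(2 ^ n) :=
  tensor_string n (fun q =>
    if (q < k./2)%N then pauliZ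
    else if q == k./2 then (if odd k then pauliY else pauliX)
    else 1%:M).

Definition gaussian (n : nat) (V : 'M[C]_(2 ^ n)) : Prop :=
  V \is unitarymx /\
  exists Q : 'M[R]_(2 * n),
    Q *m Q^T = 1%:M /\
    forall j : 'I_(2 * n),
      V *m majorana n j *m V ^t* =
      \sum_(k < 2 * n) (Q j k)%:C *: majorana n k.

(* The least element of [S]; the value is 0 if there is none, so that
   [set_min S = v] with [v != 0] entails that [v] is attained in [S]. *)
Definition set_min (S : set R) : R := xget 0 [set v | S v /\ lbound S v].

Definition unitary_extent (n : nat) (U : 'M[C]_(2 ^ n)) : R :=
  set_min [set v | exists (m : nat) (c : 'I_m -> C) (K : 'I_m -> 'M[C]_(2 ^ n)),
    [/\ forall j, gaussian (K j),
        U = \sum_j c j *: K j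
      & v = (\sum_j Normc.normc (c j)) ^+ 2]].

Definition fermionic_nonlinearity (n : nat)
    (E : 'M[C]_(2 ^ n) -> 'M[C]_(2 ^ n)) : R :=
  set_min [set v |
    exists (m : nat) (q : 'I_m -> R) (L T : 'I_m -> 'M[C]_(2 ^ n)),
    [/\ forall j, gaussian (L j) /\ gaussian (T j),
        forall rho, E rho = \sum_j (q j)%:C *: (L j *m rho *m T j)
      & v = \sum_j `|q j|]].

Definition unitary_channel {m : nat} (U : 'M[C]_m) : 'M[C]_m -> 'M[C]_m :=
  fun rho => U *m rho *m U ^t*.

Definition Cgate (theta : R) : 'M[C]_(2 ^ 2) :=
  diag_mx (\row_(j < 2 ^ 2) (if val j == 3%N then expi theta else 1)).

Definition RZZgate (theta : R) : 'M[C]_(2 ^ 2) :=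
  expmx ((- 'i * theta%:C / 2%:R) *: (pauliZ *t pauliZ)).

(* \sum_(a, b) |a><b| *t |b><a|, which maps |x, y> to |y, x>. *)
Definition SWAPgate : 'M[C]_(2 ^ 2) :=
  \sum_(a < 2) \sum_(b < 2) delta_mx a b *t delta_mx b a.

End Gates.
Arguments gaussian {R} n V.
Arguments unitary_extent {R} n U.
Arguments fermionic_nonlinearity {R} n E.
Arguments SWAPgate : clear implicits.

(* Main.v *)
Require Import Defs.
From mathcomp Require Import all_boot all_order all_algebra.
From mathcomp Require Import all_classical all_reals all_analysis.
From mathcomp.real_closed Require Import complex.
From mathcomp Require Import ring lra.

(* Let P = Z *t Z be the parity and D(a) = cos a + i sin a P. Each of the three
   gates is G *m D(a) with G Gaussian: a = theta/4 for C(theta), -theta/2 for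
   R_ZZ(theta), pi/4 for SWAP. Since G and G P are Gaussian, the decomposition
   cos a G + i sin a G P bounds the extent by (|cos a| + |sin a|)^2, which is
   1 + |sin 2a|; expanding it in U rho U^* bounds the nonlinearity by the same
   number.
   The lower bounds come from the functional V |-> e1 tr V - i e2 tr (P V),
   with e1, e2 the signs of cos a, sin a. It is 4 (|cos a| + |sin a|) at D(a),
   and at most 4 in modulus on Gaussian unitaries: an antiunitary symmetry fixes
   all the Majorana operators, so it maps a Gaussian V to a multiple of V, which
   makes the traces of V on the two parity sectors relatively real, while each
   of them has modulus at most 2. For channels one uses the product of the
   functional applied to the left factor and its conjugate applied to the right
   factor. *)

Set Implicit Arguments.
Unset Strict Implicit.
Unset Printing Implicit Defensive.

Import Order.TTheory GRing.Theory Num.Theory numFieldNormedType.Exports.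
Local Open Scope ring_scope.
Local Open Scope complex_scope.
Local Open Scope sesquilinear_scope.

Definition simp0 := (@mulr0, @mul0r, @addr0, @add0r, @mulr1, @mul1r).

(** * Explicit matrices of size 4 *)

Notation q0 := (@Ordinal (2 ^ 2) 0 isT).
Notation q1 := (@Ordinal (2 ^ 2) 1 isT).
Notation q2 := (@Ordinal (2 ^ 2) 2 isT).
Notation q3 := (@Ordinal (2 ^ 2) 3 isT).

Section FourByFour.
Variable T : pzSemiRingType.

Definition mx_rows (s : seq (seq T)) : 'M[T]_(2 ^ 2) :=
  \matrix_(i, j) nth 0 (nth [::] s i) j.

Lemma sum4E (V : nmodType) (F : 'I_(2 ^ 2) -> V) :
  \sum_i F i = F q0 + F q1 + F q2 + F q3.
Proof.
rewrite !big_ord_recl big_ord0 addr0 !addrA.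
by congr (_ + _ + _ + _); congr F; apply: val_inj.
Qed.

Lemma mulmx4E (A B : 'M[T]_(2 ^ 2)) i j :
  (A *m B) i j = A i q0 * B q0 j + A i q1 * B q1 j +
                 A i q2 * B q2 j + A i q3 * B q3 j.
Proof. by rewrite mxE sum4E. Qed.

End FourByFour.

(** The matrix product on lists of rows, so that products of explicit matrices are evaluated by
    simplification. *)
Definition mul_rows (T : pzSemiRingType) (s t : seq (seq T)) : seq (seq T) :=
  mkseq (fun i => mkseq (fun j => let e r k l := nth 0 (nth [::] r k) l in
    e s i 0%N * e t 0%N j + e s i 1%N * e t 1%N j + e s i 2%N * e t 2%N j +
    e s i 3%N * e t 3%N j) 4) 4.

Lemma mul_mx_rows (T : pzSemiRingType) (s t : seq (seq T)) :
  mx_rows s *m mx_rows t = mx_rows (mul_rows s t).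
Proof.
by apply/matrixP => i j; rewrite mulmx4E !mxE /= !nth_mkseq //.
Qed.

Lemma map_mx_rows (T T' : pzSemiRingType) (f : T -> T') s : f 0 = 0 ->
  map_mx f (mx_rows s) = mx_rows (map (map f) s).
Proof.
move=> f0; apply/matrixP => i j; rewrite !mxE.
case: (leqP (size s) i) => [gei|lti].
  by rewrite [nth _ s i]nth_default // [nth _ (map _ _) i]nth_default ?size_map // !nth_nil.
rewrite (nth_map [::]) //.
case: (leqP (size (nth [::] s i)) j) => [gej|ltj]; last by rewrite (nth_map 0).
by rewrite [_`_j]nth_default // [_`_j]nth_default ?size_map.
Qed.

Lemma ord4_ind (P : 'I_(2 ^ 2) -> Prop) :
  P q0 -> P q1 -> P q2 -> P q3 -> forall i, P i.
Proof.
move=> P0 P1 P2 P3 [[|[|[|[|i]]]] // lt_i].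
- by rewrite (_ : Ordinal _ = q0) //; apply: val_inj.
- by rewrite (_ : Ordinal _ = q1) //; apply: val_inj.
- by rewrite (_ : Ordinal _ = q2) //; apply: val_inj.
- by rewrite (_ : Ordinal _ = q3) //; apply: val_inj.
Qed.

Ltac entries4 := apply/matrixP; apply: ord4_ind; apply: ord4_ind.

(** * Majorana operators on two qubits and their antiunitary symmetry *)

Section Majorana.
Variable R : realType.
Local Notation C := R[i].

Lemma majorana0E : majorana 2 0 = mx_rows
  [:: [:: 0; 0; 1; 0]; [:: 0; 0; 0; 1]; [:: 1; 0; 0; 0]; [:: 0; 1; 0; 0]] :> 'M[C]_(2 ^ 2).
Proof. by entries4; rewrite /majorana /= !mxE /= ?mxE /= ?mul1r ?mul0r. Qed.

Lemma majorana1E : majorana 2 1 = mx_rows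
  [:: [:: 0; 0; - 'i; 0]; [:: 0; 0; 0; - 'i]; [:: 'i; 0; 0; 0]; [:: 0; 'i; 0; 0]] :> 'M[C]_(2 ^ 2).
Proof. by entries4; rewrite /majorana /= !mxE /= ?mxE /= ?mulr1 ?mulr0. Qed.

Lemma majorana2E : majorana 2 2 = mx_rows
  [:: [:: 0; 1; 0; 0]; [:: 1; 0; 0; 0]; [:: 0; 0; 0; -1]; [:: 0; 0; -1; 0]] :> 'M[C]_(2 ^ 2).
Proof.
by entries4; rewrite /majorana /= !mxE /= ?mxE /= ?(mul1r, mulr1, mul0r, mulr0, expr1, expr0).
Qed.

Lemma majorana3E : majorana 2 3 = mx_rows
  [:: [:: 0; - 'i; 0; 0]; [:: 'i; 0; 0; 0]; [:: 0; 0; 0; 'i]; [:: 0; 0; - 'i; 0]] :> 'M[C]_(2 ^ 2).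
Proof.
by entries4; rewrite /majorana /= !mxE /= ?mxE /=
   ?(mul1r, mulr1, mul0r, mulr0, expr1, expr0, mulN1r, opprK).
Qed.

Definition majoranaE := (majorana0E, majorana1E, majorana2E, majorana3E).

(** The Majorana operators generate the full matrix algebra. Concretely, the two operators of each
    pair force the off-diagonal entries to vanish, and [majorana 2 0] and [majorana 2 2] equate the
    diagonal ones. *)
Lemma majorana_commutant (M : 'M[C]_(2 ^ 2)) :
  (forall j : 'I_(2 * 2), M *m majorana 2 j = majorana 2 j *m M) ->
  M = (M q0 q0)%:M.
Proof.
move=> comM.
have c0 := comM q0; have c1 := comM q1; have c2 := comM q2.
have c3 := comM q3.
rewrite /= majoranaE in c0; rewrite /= majoranaE in c1.
rewrite /= majoranaE in c2; rewrite /= majoranaE in c3.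
have {}c0 i j := congr1 (fun A => fun_of_matrix A i j) c0.
have {}c1 i j := congr1 (fun A => fun_of_matrix A i j) c1.
have {}c2 i j := congr1 (fun A => fun_of_matrix A i j) c2.
have {}c3 i j := congr1 (fun A => fun_of_matrix A i j) c3.
have i0 : ('i : C) != 0 by rewrite eq_complex /= oner_eq0 andbF.
(* The same entry of the commutation relations with the X-type and the Y-type operator of a pair
   yields these two equations. *)
have eq0 (x y : C) : x = y -> x * 'i = - 'i * y -> x = 0 /\ y = 0.
  move=> -> h; suff -> : y = 0 by [].
  have : (2 * 'i : C) * y = 0 by rewrite -mulrA ['i * y]mulrC mulr_natl mulr2n {1}h; ring.
  by move/eqP; rewrite !mulf_eq0 pnatr_eq0 /= (negPf i0) => /eqP.
have [M02 M20] : M q0 q2 = 0 /\ M q2 q0 = 0.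
  by move: (c0 q0 q0) (c1 q0 q0); rewrite !mulmx4E !mxE /= ?simp0; exact: eq0.
have [M03 M21] : M q0 q3 = 0 /\ M q2 q1 = 0.
  by move: (c0 q0 q1) (c1 q0 q1); rewrite !mulmx4E !mxE /= ?simp0; exact: eq0.
have [M12 M30] : M q1 q2 = 0 /\ M q3 q0 = 0.
  by move: (c0 q1 q0) (c1 q1 q0); rewrite !mulmx4E !mxE /= ?simp0; exact: eq0.
have [M13 M31] : M q1 q3 = 0 /\ M q3 q1 = 0.
  by move: (c0 q1 q1) (c1 q1 q1); rewrite !mulmx4E !mxE /= ?simp0; exact: eq0.
have [M01 M10] : M q0 q1 = 0 /\ M q1 q0 = 0.
  by move: (c2 q0 q0) (c3 q0 q0); rewrite !mulmx4E !mxE /= ?simp0; exact: eq0.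
have [M23 M32] : M q2 q3 = 0 /\ M q3 q2 = 0.
  move: (c2 q2 q2) (c3 q2 q2); rewrite !mulmx4E !mxE /= ?simp0 mulrN1 mulN1r.
  by move=> /oppr_inj h1 h2; apply: eq0 => //; rewrite mulNr -h2 mulrN opprK.
have M11 : M q0 q0 = M q1 q1.
  by move: (c2 q0 q1); rewrite !mulmx4E !mxE /= ?simp0.
have M22 : M q0 q0 = M q2 q2.
  by move: (c0 q0 q2); rewrite !mulmx4E !mxE /= ?simp0.
have M33 : M q1 q1 = M q3 q3.
  by move: (c0 q1 q3); rewrite !mulmx4E !mxE /= ?simp0.
by entries4; rewrite [RHS]mxE /= ?mulr0n ?mulr1n // -?M33 -?M22 -?M11.
Qed.

(* cconj = X *t iY, and M |-> cconj^-1 M^conj cconj is the antiunitary symmetry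
   that fixes the Majorana operators. *)
Definition cconj : 'M[C]_(2 ^ 2) := mx_rows
  [:: [:: 0; 0; 0; 1]; [:: 0; 0; -1; 0]; [:: 0; 1; 0; 0]; [:: -1; 0; 0; 0]].

(** Hence the inverse of [cconj] is [- cconj], and up to sign the symmetry reads
    [cconj *m map_mx conjc V *m cconj]. *)
Lemma cconj_sqr : cconj *m cconj = - 1%:M.
Proof.
rewrite mul_mx_rows /mul_rows /mkseq /= !simp0 ?(mulr1, mul1r, mulrN1, mulN1r, opprK).
by entries4; rewrite !mxE /= ?mulr0n ?mulr1n ?oppr0.
Qed.

Lemma cconj_majorana (j : 'I_(2 * 2)) :
  cconj *m map_mx conjc (majorana 2 j) = majorana 2 j *m cconj.
Proof.
(* Signs are pushed into real and imaginary parts, which makes both sides syntactically equal. *)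
have oppC (a b : R) : - (a +i* b) = - a +i* - b :> C by [].
have N1 : -1 = -1 +i* 0 :> C by rewrite -[1 in LHS]/(1 +i* 0) oppC oppr0.
have Ni : - 'i = 0 +i* -1 :> C by rewrite oppC oppr0.
elim/ord4_ind: j; rewrite /= majoranaE (map_mx_rows _ (conjc0 R)) !mul_mx_rows.
all: rewrite /mul_rows /mkseq /= !simp0 ?mulrN1 ?mulN1r ?opprK.
all: by rewrite ?N1 ?Ni ?oppC ?oppr0 ?opprK.
Qed.

(* The transform of V acts on the Majorana operators as V itself does, so the
   quotient of the two commutes with them and is a scalar. *)
Lemma majorana_symmetry (V : 'M[C]_(2 ^ 2)) : gaussian 2 V ->
  exists lam, cconj *m map_mx conjc V *m cconj = lam *: V.
Proof.
move=> [uV [Q [QT VQ]]].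
pose c' j := \sum_(k < 2 * 2) (Q j k)%:C *: majorana 2 k.
have VV : V *m V^t* = 1%:M by apply/unitarymxP.
have VV' : V^t* *m V = 1%:M by apply: mulmx1C.
have Vc (j : 'I_(2 * 2)) : V *m majorana 2 j = c' j *m V by rewrite /c' -VQ -!mulmxA VV' mulmx1.
have cV (j : 'I_(2 * 2)) : V^t* *m c' j = majorana 2 j *m V^t*.
  by rewrite /c' -VQ !mulmxA VV' mul1mx.
(* The coefficients of [c' j] are real, so the symmetry fixes [c' j] as well. *)
have c'J (j : 'I_(2 * 2)) : cconj *m map_mx conjc (c' j) = c' j *m cconj.
  rewrite /c' raddf_sum mulmx_sumr mulmx_suml; apply: eq_bigr => k _.
  rewrite /= map_mxZ /= -scalemxAr cconj_majorana -scalemxAl; congr (_ *: _).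
  by rewrite /= oppr0.
pose N := cconj *m map_mx conjc V *m cconj.
have Nc (j : 'I_(2 * 2)) : N *m majorana 2 j = c' j *m N.
  (* The intertwining relation with the conjugation on the other side, obtained by inserting
     [cconj *m cconj]. *)
  have Jc : cconj *m majorana 2 j = map_mx conjc (majorana 2 j) *m cconj.
    apply: oppr_inj.
    rewrite -[in RHS](mul1mx (map_mx _ _)) -!mulNmx -cconj_sqr.
    rewrite -[cconj *m cconj *m _]mulmxA cconj_majorana -!mulmxA cconj_sqr.
    by rewrite mulmxN mulmx1 mulmxN mulNmx.
  rewrite /N -mulmxA Jc -!mulmxA [map_mx _ V *m (_ *m _)]mulmxA -map_mxM Vc.
  by rewrite map_mxM !mulmxA c'J.
have M1 : V^t* *m N = ((V^t* *m N) q0 q0)%:M.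
  by apply: majorana_commutant => j; rewrite -mulmxA Nc !mulmxA cV.
by exists ((V^t* *m N) q0 q0); rewrite -mul_mx_scalar -M1 mulmxA VV mul1mx.
Qed.

(** [cconj] exchanges basis vectors within each parity sector, 0 with 3 and 1 with 2, with opposite
    signs. The diagonal entries of the symmetry therefore conjugate both sector traces with the
    common factor [- lam]. *)
Lemma parity_trace_conj (V : 'M[C]_(2 ^ 2)) : gaussian 2 V ->
  exists lam, (V q0 q0 + V q3 q3)^* = lam * (V q0 q0 + V q3 q3) /\
              (V q1 q1 + V q2 q2)^* = lam * (V q1 q1 + V q2 q2).
Proof.
move=> /majorana_symmetry[lam] E; exists (- lam).
have {}E i j := congr1 (fun A => fun_of_matrix A i j) E.
have := E q0 q0; have := E q1 q1; have := E q2 q2; have := E q3 q3.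
rewrite !mulmx4E !mxE /= ?simp0 !rmorphD /= !mulN1r !mulrN1 !mulNr !mulrDr => <- <- <- <-.
by rewrite !opprD !opprK; split; rewrite addrC.
Qed.
End Majorana.

(** * Closure properties of Gaussian unitaries *)

Section GaussianGroup.
Variables (R : realType) (n : nat).
Local Notation C := R[i].
Implicit Types V W : 'M[C]_(2 ^ n).

Lemma gaussian1 : gaussian n (1%:M : 'M[C]_(2 ^ n)).
Proof.
split; first by apply/unitarymxP; rewrite trmx1 map_mx1 mulmx1.
exists 1%:M; split=> [|j]; first by rewrite trmx1 mulmx1.
rewrite trmx1 map_mx1 mulmx1 mul1mx (bigD1 j) //= mxE eqxx scale1r big1 ?addr0 //.
by move=> k kj; rewrite mxE eq_sym (negPf kj) scale0r.
Qed.

Lemma gaussian_mul V W : gaussian n V -> gaussian n W -> gaussian n (V *m W).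
Proof.
move=> [uV [Q [QT VQ]]] [uW [S [ST WS]]]; split; first exact: mul_unitarymx.
(* [W] acts first, and [V] then rotates each operator of the resulting combination; hence the
   reversed order. *)
exists (S *m Q); split.
  by rewrite trmx_mul mulmxA -[S *m Q *m _]mulmxA QT mulmx1.
move=> j; rewrite trmx_mul map_mxM !mulmxA -(mulmxA V W) -(mulmxA V) WS.
rewrite mulmx_sumr mulmx_suml.
transitivity (\sum_(l < 2 * n) \sum_(k < 2 * n) ((S j l)%:C * (Q l k)%:C) *: majorana (R := R) n k).
  apply: eq_bigr => l _; rewrite -scalemxAr -scalemxAl VQ scaler_sumr.
  by apply: eq_bigr => k _; rewrite scalerA.
rewrite exchange_big /=; apply: eq_bigr => k _; rewrite -scaler_suml; congr (_ *: _).
by rewrite mxE rmorph_sum /=; apply: eq_bigr => l _; rewrite rmorphM.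
Qed.

Lemma gaussian_adj V : gaussian n V -> gaussian n (V^t*).
Proof.
move=> [uV [Q [QT VQ]]]; split; first by rewrite trmxC_unitary.
exists Q^T; rewrite trmxK; split; first exact: mulmx1C.
move=> j; rewrite trmxCK.
have VV : V^t* *m V = 1%:M by apply: mulmx1C; apply/unitarymxP.
(* By orthogonality of [Q], each Majorana operator is a combination of the rotated ones; conjugating
   by [V^t*] then removes [V]. *)
have <- : \sum_(k < 2 * n) (Q^T j k)%:C *: (V *m majorana n k *m V^t*) = majorana n j.
  transitivity (\sum_(k < 2 * n) \sum_(l < 2 * n) ((Q k j)%:C * (Q k l)%:C) *: majorana (R := R) n l).
    by apply: eq_bigr => l _; rewrite VQ mxE scaler_sumr; apply: eq_bigr => k _; rewrite scalerA.
  have QTQ : Q^T *m Q = 1%:M by apply: mulmx1C.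
  rewrite exchange_big /= (bigD1 j) //= [X in _ + X]big1 ?addr0.
    rewrite -scaler_suml [X in X *: _](_ : _ = 1) ?scale1r //.
    have /(congr1 (fun A => fun_of_matrix A j j)) := QTQ.
    rewrite !mxE eqxx => /(congr1 (real_complex R)).
    rewrite rmorph_sum /= => H; apply: etrans H; apply: eq_bigr => k _; by rewrite mxE rmorphM.
  move=> k kj; rewrite -scaler_suml [X in X *: _](_ : _ = 0) ?scale0r //.
  have /(congr1 (fun A => fun_of_matrix A j k)) := QTQ.
  rewrite !mxE eq_sym (negPf kj) => /(congr1 (real_complex R)).
  rewrite rmorph_sum /= => H; apply: etrans H; apply: eq_bigr => l _; by rewrite mxE rmorphM.
rewrite mulmx_sumr mulmx_suml; apply: eq_bigr => k _.
by rewrite -scalemxAr -scalemxAl !mulmxA VV mul1mx -mulmxA VV mulmx1.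
Qed.

(** A phase cancels under conjugation, so the orthogonal matrix is unchanged. *)
Lemma gaussian_scale (z : C) V : z * z^* = 1 -> gaussian n V -> gaussian n (z *: V).
Proof.
move=> zz [uV [Q [QT VQ]]].
have E : (z *: V)^t* = z^* *: V^t* by rewrite linearZ map_mxZ.
split.
  apply/unitarymxP; rewrite E -scalemxAl -scalemxAr scalerA zz scale1r.
  exact/unitarymxP.
exists Q; split=> // j; rewrite E -VQ.
by rewrite -!(scalemxAl, scalemxAr) scalerA zz scale1r.
Qed.

End GaussianGroup.

(** * Minima, and trace functionals of superoperators *)

Section Minimum.
Variable R : realType.
Local Notation C := R[i].

Lemma set_minE (S : set R) v : S v -> lbound S v -> set_min S = v.
Proof.
move=> Sv lbv; apply: xget_unique => // w [Sw lbw].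
by apply/eqP; rewrite eq_le lbv // lbw.
Qed.

(* A superoperator rho |-> sum_j q j L_j rho T_j determines sum_j q j L_j *t T_j. *)
Lemma tr_mul_sandwich (m p : nat) (q : 'I_p -> C) (X Y A B : 'M[C]_m)
    (L T : 'I_p -> 'M[C]_m) :
  (forall rho, X *m rho *m Y = \sum_j q j *: (L j *m rho *m T j)) ->
  \tr (A *m X) * \tr (B *m Y) =
  \sum_j q j * (\tr (A *m L j) * \tr (B *m T j)).
Proof.
move=> XY.
(* The entry [j k] of [U *m delta_mx i l *m W] is [U j i * W l k], so the product of traces depends
   linearly on the superoperator alone. *)
have E (U W : 'M[C]_m) : \tr (A *m U) * \tr (B *m W) =
    \sum_i \sum_l \sum_j \sum_k A i j * B k l * (U *m delta_mx i l *m W) j k.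
  rewrite /mxtrace mulr_suml; apply: eq_bigr => i _; rewrite !mxE.
  have -> : \sum_k (B *m W) k k = \sum_l \sum_k B k l * W l k.
    by rewrite exchange_big; apply: eq_bigr => k _; rewrite mxE.
  rewrite mulr_sumr; apply: eq_bigr => l _.
  rewrite mulr_suml; apply: eq_bigr => j _.
  rewrite mulr_sumr; apply: eq_bigr => k _.
  rewrite mxE (bigD1 l) //= big1 ?addr0; last first.
    by move=> l' nl; rewrite mxE big1 ?mul0r // => i' _; rewrite mxE (negPf nl) andbF mulr0.
  rewrite mxE (bigD1 i) //= big1 ?addr0; last first.
    by move=> i' ni; rewrite mxE (negPf ni) mulr0.
  by rewrite mxE !eqxx mulr1; ring.
(* The sum over the decomposition moves inside the four index sums, where the hypothesis is applied
   to [delta_mx i l]. *)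
rewrite E.
under [RHS]eq_bigr => t _ do rewrite E mulr_sumr.
rewrite [RHS]exchange_big; apply: eq_bigr => i _.
under [RHS]eq_bigr => t _ do rewrite mulr_sumr.
rewrite [RHS]exchange_big; apply: eq_bigr => l _.
under [RHS]eq_bigr => t _ do rewrite mulr_sumr.
rewrite [RHS]exchange_big; apply: eq_bigr => j _.
under [RHS]eq_bigr => t _ do rewrite mulr_sumr.
rewrite [RHS]exchange_big; apply: eq_bigr => k _.
rewrite XY summxE mulr_sumr; apply: eq_bigr => t _.
by rewrite [in LHS]mxE mulrCA.
Qed.

End Minimum.

(** * Explicit Gaussian gates *)

Section Gates.
Variable R : realType.
Local Notation C := R[i].

Lemma imaginaryE : 'i%R = 'i%C :> C.
Proof. by []. Qed.

Lemma majorana_comb (a b c d : C) :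
  a *: majorana 2 0 + b *: majorana 2 1 + c *: majorana 2 2 + d *: majorana 2 3 =
  mx_rows [:: [:: 0; c - 'i * d; a - 'i * b; 0];
              [:: c + 'i * d; 0; 0; a - 'i * b];
              [:: a + 'i * b; 0; 0; - c + 'i * d];
              [:: 0; a + 'i * b; - c - 'i * d; 0]].
Proof. by rewrite !majoranaE; entries4; rewrite !mxE /= ?imaginaryE; ring. Qed.

(** The adjoint is moved to the other side, leaving an identity between products of explicit
    matrices. *)
Lemma gaussian_rowsI (V : 'M[C]_(2 ^ 2)) (Q : seq (seq R)) :
  V \is unitarymx -> mx_rows Q *m (mx_rows Q)^T = 1%:M ->
  (forall j : 'I_(2 ^ 2), let q k := (nth 0 (nth [::] Q j) k)%:C in
    V *m majorana 2 j = (q 0%N *: majorana 2 0 + q 1%N *: majorana 2 1 +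
      q 2%N *: majorana 2 2 + q 3%N *: majorana 2 3) *m V) ->
  gaussian 2 V.
Proof.
move=> uV QQ VQ; split=> //; exists (mx_rows Q); split=> // j.
rewrite VQ -mulmxA (unitarymxP _) // mulmx1.
rewrite -(sum4E (fun k => (nth 0 (nth [::] Q j) k)%:C *: majorana (R := R) 2 k)).
by apply: eq_bigr => k _; rewrite mxE.
Qed.

Definition zz : 'M[C]_(2 ^ 2) := mx_rows
  [:: [:: 1; 0; 0; 0]; [:: 0; -1; 0; 0]; [:: 0; 0; -1; 0]; [:: 0; 0; 0; 1]].

Lemma pauliZZ : mxtens.tensmx pauliZ pauliZ = zz.
Proof.
by entries4; rewrite !mxE /= ?mxE /= ?(oppr0, expr0, expr1, mul0r, mulr0, mul1r, mulr1, mulN1r, opprK).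
Qed.

Lemma zz_sqr : zz *m zz = 1%:M.
Proof.
rewrite mul_mx_rows /mul_rows /mkseq /= !simp0 mulN1r opprK.
by entries4; rewrite !mxE.
Qed.

Lemma adj_zz : zz^t* = zz.
Proof. by entries4; rewrite !mxE /= ?rmorphN ?rmorph1 ?rmorph0. Qed.

(** Parity anticommutes with every Majorana operator, so the orthogonal matrix is minus the
    identity. *)
Lemma gaussian_zz : gaussian 2 zz.
Proof.
apply: (@gaussian_rowsI _ [:: [:: -1; 0; 0; 0]; [:: 0; -1; 0; 0]; [:: 0; 0; -1; 0]; [:: 0; 0; 0; -1]]).
- by apply/unitarymxP; rewrite adj_zz zz_sqr.
- by entries4; rewrite mulmx4E !mxE /=; ring.
- apply: ord4_ind; rewrite /= majorana_comb majoranaE !mul_mx_rows /mul_rows /mkseq /=;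
  rewrite ?rmorphN ?rmorph1 ?rmorph0 !simp0 ?(mulrN1, mulN1r, oppr0, opprK, simp0) //.
Qed.

(* exp (-i t (Z *t I + I *t Z) / 2), which rotates both Majorana pairs by t. *)
Lemma gaussian_zrot (e f : C) (c s : R) :
  c ^+ 2 + s ^+ 2 = 1 ->
  e = c%:C + 'i * s%:C -> f = c%:C - 'i * s%:C ->
  gaussian 2 (mx_rows
    [:: [:: f; 0; 0; 0]; [:: 0; 1; 0; 0]; [:: 0; 0; 1; 0]; [:: 0; 0; 0; e]]).
Proof.
move=> cs eE fE.
have ii : 'i * 'i = -1 :> C by rewrite -expr2 sqr_i.
have csC : c%:C * c%:C + s%:C * s%:C = 1 by rewrite -!rmorphM -rmorphD /= -!expr2 cs.
have ef : e * f = 1.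
  rewrite eE fE.
  have -> : (c%:C + 'i * s%:C) * (c%:C - 'i * s%:C) =
    c%:C * c%:C - 'i * 'i * (s%:C * s%:C) :> C by ring.
  by rewrite ii mulN1r opprK csC.
have fe : f * e = 1 by rewrite mulrC.
have ce : conjc e = f.
  by rewrite eE fE; apply/eqP; rewrite eq_complex /=; apply/andP; split; apply/eqP; ring.
have cf : conjc f = e by rewrite -ce conjcK.
apply: (@gaussian_rowsI _ [:: [:: c; s; 0; 0]; [:: - s; c; 0; 0];
                              [:: 0; 0; c; s]; [:: 0; 0; - s; c]]).
- apply/unitarymxP.
  rewrite [X in _ *m X](_ : _ = mx_rows
     [:: [:: e; 0; 0; 0]; [:: 0; 1; 0; 0]; [:: 0; 0; 1; 0]; [:: 0; 0; 0; f]]).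
    rewrite mul_mx_rows /mul_rows /mkseq /= !simp0 ef fe.
    by entries4; rewrite !mxE.
  by entries4; rewrite !mxE /= ?[_^*%R]cf ?[_^*%R]ce ?rmorph1 ?rmorph0.
- by entries4; rewrite mulmx4E !mxE /= ?mulr0n ?mulr1n; lra.
(* These identities express the entries of the rotated operators as multiples of [e] and [f], after
   which [ef] and [fe] suffice. *)
- have fsE : - s%:C - 'i * c%:C = - 'i * f by rewrite fE; transitivity (('i * 'i) * s%:C - 'i * c%:C); [rewrite ii; ring | ring].
  have esE : - s%:C + 'i * c%:C = 'i * e by rewrite eE; transitivity (('i * 'i) * s%:C + 'i * c%:C); [rewrite ii; ring | ring].
  have fsE' : - - s%:C + 'i * c%:C = 'i * f by rewrite opprK -[LHS]opprK opprD fsE; ring.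
  have esE' : - - s%:C - 'i * c%:C = - 'i * e by rewrite opprK -[LHS]opprK opprD opprK esE; ring.
  have esE'' : - c%:C - 'i * s%:C = - e by rewrite eE; ring.
  have fsE'' : - c%:C + 'i * s%:C = - f by rewrite fE; ring.
  apply: ord4_ind; rewrite /= majorana_comb majoranaE !mul_mx_rows /mul_rows /mkseq /=.
  all: rewrite ?rmorphN ?rmorph0 !simp0 -?eE -?fE ?(fsE, esE, fsE', esE', fsE'', esE'') ?(oppr0, simp0).
  all: rewrite ?mulNr -?mulrA ?(ef, fe, simp0, mulrN1, mulN1r, mulrN, mulrC f 'i, mulrC e 'i) //.
  all: try by [].
Qed.

(** The iSWAP gate: it exchanges the two Majorana pairs up to order and signs, sending operators 0,
    1, 2, 3 to 3, -2, 1, -0. *)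
Lemma gaussian_iswap : gaussian 2 (mx_rows (T := C)
    [:: [:: 1; 0; 0; 0]; [:: 0; 0; 'i; 0]; [:: 0; 'i; 0; 0]; [:: 0; 0; 0; 1]]).
Proof.
have ii : 'i * 'i = -1 :> C by rewrite -expr2 sqr_i.
apply: (@gaussian_rowsI _ [:: [:: 0; 0; 0; 1]; [:: 0; 0; -1; 0];
                              [:: 0; 1; 0; 0]; [:: -1; 0; 0; 0]]).
- apply/unitarymxP.
  rewrite [X in _ *m X](_ : _ = mx_rows
     [:: [:: 1; 0; 0; 0]; [:: 0; 0; - 'i; 0]; [:: 0; - 'i; 0; 0]; [:: 0; 0; 0; 1]]).
    rewrite mul_mx_rows /mul_rows /mkseq /= !simp0 ?imaginaryE mulrN ii opprK.
    by entries4; rewrite !mxE.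
  by entries4; rewrite !mxE /= ?rmorph1 ?rmorph0 //; apply/eqP; rewrite eq_complex /= ?oppr0 !eqxx.
- by entries4; rewrite mulmx4E !mxE /=; ring.
- apply: ord4_ind; rewrite /= majorana_comb majoranaE !mul_mx_rows /mul_rows /mkseq /=.
  all: rewrite ?imaginaryE ?rmorphN ?rmorph1 ?rmorph0 !simp0 ?(mulrN1, mulN1r, oppr0, opprK, simp0).
  all: rewrite ?(mulrN, mulNr, ii, oppr0, opprK, simp0) //.
Qed.
End Gates.

(** * The functional behind the lower bounds *)

Section Witness.
Variable R : realType.
Local Notation C := R[i].
Implicit Types x y : C.

Lemma conjcD x y : conjc (x + y) = conjc x + conjc y. Proof. exact: rmorphD. Qed.
Lemma conjcN x : conjc (- x) = - conjc x. Proof. exact: rmorphN. Qed.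
Lemma conjcM x y : conjc (x * y) = conjc x * conjc y. Proof. exact: rmorphM. Qed.
Lemma conjc_i : conjc 'i = - 'i :> C.
Proof. by apply/eqP; rewrite eq_complex /= oppr0 !eqxx. Qed.
Lemma real_complexM (r t : R) : (r * t)%:C = r%:C * t%:C :> C.
Proof. exact: rmorphM. Qed.
Lemma real_complexD (r t : R) : (r + t)%:C = r%:C + t%:C :> C.
Proof. exact: rmorphD. Qed.
Lemma normc_ge0 (x : C) : 0 <= Normc.normc x.
Proof. by case: x => r t; rewrite sqrtr_ge0. Qed.
Lemma real_complex_nat (n : nat) : (n%:R : R)%:C = n%:R :> C.
Proof. exact: rmorph_nat. Qed.
Lemma sqr_im : 'i * 'i = -1 :> C. Proof. by rewrite -expr2 sqr_i. Qed.
Local Notation zz := (@zz R).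

Lemma unitarymx_entry_le1 (n : nat) (V : 'M[C]_n) i j :
  V \is unitarymx -> `|V i j| <= 1.
Proof.
move=> /unitarymxP /(congr1 (fun A => fun_of_matrix A i i)).
rewrite !mxE eqxx mulr1n (bigD1 j) //= !mxE => VV.
rewrite -(@expr_le1 _ 2) // normCK -VV lerDl sumr_ge0 // => k _.
by rewrite !mxE -normCK exprn_ge0.
Qed.

Definition witness (e1 e2 : R) : 'M[C]_(2 ^ 2) :=
  e1%:C *: 1%:M - ('i * e2%:C) *: zz.

(** The diagonal is grouped into the traces on the even sector, indices 0 and 3, and the odd one,
    indices 1 and 2. *)
Lemma tr_witness e1 e2 (V : 'M[C]_(2 ^ 2)) :
  \tr (witness e1 e2 *m V) =
  e1%:C * ((V q0 q0 + V q3 q3) + (V q1 q1 + V q2 q2)) -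
  'i * e2%:C * ((V q0 q0 + V q3 q3) - (V q1 q1 + V q2 q2)).
Proof.
rewrite mulmxBl -!scalemxAl mul1mx raddfB /= !mxtraceZ; congr (_ * _ - _ * _).
  by rewrite /mxtrace sum4E; ring.
by rewrite /mxtrace sum4E !mulmx4E !mxE /=; ring.
Qed.

(** With [a] and [b] the sector traces, the cross terms of the squared modulus cancel because [a]
    and [b] are relatively real. What remains is [2 * (|a|^2 + |b|^2)], at most 16. *)
Lemma gaussian_witness_le4 e1 e2 (V : 'M[C]_(2 ^ 2)) :
  e1 ^+ 2 = 1 -> e2 ^+ 2 = 1 -> gaussian 2 V ->
  `|\tr (witness e1 e2 *m V)| <= 4.
Proof.
move=> e11 e21 gV; have [uV _] := gV.
rewrite tr_witness.
have [lam []] := parity_trace_conj gV.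
set a := _ + _; set b := _ + _ => aE bE.
have le2 (x y : C) : `|x| <= 1 -> `|y| <= 1 -> `|x + y| <= 2.
  move=> x1 y1; by apply: le_trans (ler_normD _ _) _; rewrite -[2]/(1 + 1) lerD.
have a2 : `|a| <= 2 by apply: le2; apply: unitarymx_entry_le1.
have b2 : `|b| <= 2 by apply: le2; apply: unitarymx_entry_le1.
rewrite -(@ler_pXn2r _ 2) ?nnegrE //.
have -> : `|e1%:C * (a + b) - 'i * e2%:C * (a - b)| ^+ 2 = 2 * (`|a| ^+ 2 + `|b| ^+ 2).
  rewrite !sqr_normc.
  (* Both conjugates carry the same factor [lam]. *)
  have ab : b * conjc a = a * conjc b by rewrite aE bE; ring.
  have E1 : e1%:C * e1%:C = 1 :> C by rewrite -rmorphM -expr2 e11.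
  have E2 : e2%:C * e2%:C = 1 :> C by rewrite -rmorphM -expr2 e21.
  have -> : conjc (e1%:C * (a + b) - 'i * e2%:C * (a - b)) =
      e1%:C * (conjc a + conjc b) + 'i * e2%:C * (conjc a - conjc b).
    by rewrite !(conjcD, conjcN, conjcM) conjc_i !conjc_real; ring.
  transitivity ((e1%:C * e1%:C) * (a + b) * (conjc a + conjc b)
     - ('i * 'i) * (e2%:C * e2%:C) * (a - b) * (conjc a - conjc b)
     + 'i * e1%:C * e2%:C * 2 * (b * conjc a - a * conjc b)); first by ring.
  by rewrite ab sqr_im E1 E2; ring.
apply: (@le_trans _ _ (2 * (2 ^+ 2 + 2 ^+ 2))).
  by rewrite ler_pM2l // lerD // ler_pXn2r // ?nnegrE.
by rewrite -natrX -natrD -natrM -natrX.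
Qed.

(* exp (i a Z *t Z) *)
Definition zz_rotation (a : R) : 'M[C]_(2 ^ 2) :=
  (cos a)%:C *: 1%:M + ('i * (sin a)%:C) *: zz.

Lemma zz_rotationE a : zz_rotation a = mx_rows
  [:: [:: expi a; 0; 0; 0]; [:: 0; expi (- a); 0; 0];
      [:: 0; 0; expi (- a); 0]; [:: 0; 0; 0; expi a]].
Proof.
have expiE t : expi t = (cos t)%:C + 'i * (sin t)%:C :> C.
  by apply/eqP; rewrite eq_complex /=; apply/andP; split; apply/eqP; ring.
entries4; rewrite !mxE /= ?expiE ?cosN ?sinN ?rmorphN /= ?mulr0n ?mulr1n; ring.
Qed.

(** Parity is traceless with square 1, so only the matching terms survive; the factor -i makes the
    sine term real. *)
Lemma tr_witness_zz_rotation e1 e2 a :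
  \tr (witness e1 e2 *m zz_rotation a) = (4 * (e1 * cos a + e2 * sin a))%:C.
Proof.
rewrite tr_witness !mxE /= ?mulr0n ?mulr1n.
rewrite real_complexM real_complex_nat real_complexD !real_complexM.
transitivity (4 * (e1%:C * (cos a)%:C - ('i * 'i) * (e2%:C * (sin a)%:C)) : C).
  by ring.
by rewrite sqr_im; ring.
Qed.
End Witness.

(** * Extent and nonlinearity of a Gaussian unitary times a parity rotation *)

Section Extent.
Variables (R : realType) (G : 'M[R[i]]_(2 ^ 2)) (a : R).
Hypothesis gG : gaussian 2 G.
Local Notation C := R[i].
Let s : R := `|cos a| + `|sin a|.
(** This sign is 1 at 0, so its square is always 1. *)
Let e1 := (-1) ^+ (cos a < 0)%R : R.
Let e2 := (-1) ^+ (sin a < 0)%R : R.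
Let U := G *m zz_rotation a.
(** The factor [G^t*] cancels [G] in [U], and the bound 4 persists because [G^t* *m V] is Gaussian
    whenever [V] is. *)
Let A := witness e1 e2 *m G^t*.
Local Notation zz := (@zz R).

Lemma sqr_abs_cos_sin : s ^+ 2 = 1 + `|sin (2 * a)|.
Proof.
rewrite mulr_natl sin_mulr2n -mulr_natl !normrM normr_nat /s.
rewrite sqrrD !real_normK ?num_real // -mulr_natl.
by have := cos2Dsin2 a; lra.
Qed.

Let GG : G^t* *m G = 1%:M.
Proof. by case: gG => /unitarymxP h _; apply: mulmx1C. Qed.

Let trAU : \tr (A *m U) = (4 * s)%:C.
Proof.
rewrite /A /U mulmxA -[_ *m G^t* *m G]mulmxA GG mulmx1 tr_witness_zz_rotation.
by rewrite /s !normrEsign.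
Qed.

Let trA_le V : gaussian 2 V -> `|\tr (A *m V)| <= 4.
Proof.
move=> gV; rewrite /A -mulmxA; apply: gaussian_witness_le4; rewrite ?sqrr_sign //.
exact: gaussian_mul (gaussian_adj gG) gV.
Qed.

Lemma unitary_extent_zz_rotation : unitary_extent 2 U = 1 + `|sin (2 * a)|.
Proof.
rewrite -sqr_abs_cos_sin; apply: set_minE => [|v [m [c [K [gK UE ->]]]]] /=.
  exists 2%N, (fun j : 'I_2 => if j == ord0 then (cos a)%:C else 'i * (sin a)%:C).
  exists (fun j : 'I_2 => if j == ord0 then G else G *m zz); split.
  - move=> j; case: ifP => _ //; exact: gaussian_mul gG (gaussian_zz R).
  - by rewrite !big_ord_recl big_ord0 addr0 /= /U mulmxDr -!scalemxAr mulmx1.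
  - rewrite !big_ord_recl big_ord0 addr0 /=; congr (_ ^+ 2); congr (_ + _).
      by rewrite expr0n addr0 sqrtr_sqr.
    by rewrite !mul0r !mul1r subr0 expr0n !add0r sqrtr_sqr.
have s0 : 0 <= s by rewrite addr_ge0.
rewrite ler_pXn2r ?nnegrE ?sumr_ge0 // => [|j _]; last exact: normc_ge0.
(* [4 * s] is the value of the functional at [U], and each Gaussian term of the decomposition
   contributes at most 4 times its weight. *)
suff : (4 * s)%:C <= 4%:C * (\sum_j Normc.normc (c j))%:C :> C.
  by rewrite -rmorphM lecR ler_pM2l.
have -> : (4 * s)%:C = `|(4 * s)%:C| :> C by rewrite ger0_norm // lecR mulr_ge0.
rewrite -trAU UE mulmx_sumr raddf_sum.
apply: le_trans (ler_norm_sum _ _ _) _.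
rewrite mulrC rmorph_sum mulr_suml; apply: ler_sum => j _.
rewrite -scalemxAr /= mxtraceZ normrM.
by rewrite ler_wpM2l // (le_trans (trA_le (gK j))) //= real_complex_nat.
Qed.

Lemma nonlinearity_zz_rotation :
  fermionic_nonlinearity 2 (unitary_channel U) = 1 + `|sin (2 * a)|.
Proof.
rewrite -sqr_abs_cos_sin; apply: set_minE => [|v [m [q [L [T [gLT UE ->]]]]]] /=.
  pose c := cos a; pose d := sin a.
  have gZ : gaussian 2 (G *m zz) by exact: gaussian_mul gG (gaussian_zz R).
  (* The cross terms carry phases i and -i while the weights must be real, so these phases are
     absorbed into Gaussian factors. *)
  have gi : gaussian 2 ('i%C *: (G *m zz)).
    by apply: gaussian_scale gZ; rewrite [_^*%R]conjc_i mulrN sqr_im opprK.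
  (* The four terms of the expanded channel; the absolute weights add up to [(|c| + |d|)^2]. *)
  exists 4%N, (tnth [tuple c ^+ 2; d ^+ 2; c * d; c * d]).
  exists (tnth [tuple G; G *m zz; 'i%C *: (G *m zz); G]).
  exists (tnth [tuple G^t*; (G *m zz)^t*; G^t*; ('i%C *: (G *m zz))^t*]).
  split.
  - by elim/ord4_ind; split; rewrite //; apply: gaussian_adj.
  - move=> rho; rewrite (sum4E (fun j => _)) /=.
    rewrite !(tnth_nth 0) /=.
    have Us : U^t* = c%:C *: G^t* + (- 'i%C * d%:C) *: (G *m zz)^t*.
      rewrite /U mulmxDr -!scalemxAr mulmx1 linearD !linearZ map_mxD !map_mxZ /=.
      rewrite -/c -/d; congr (_ *: _ + _); first exact: conjc_real.
      by congr (_ *: _); rewrite [LHS]conjcM conjc_i conjc_real.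
    have iZ : ('i%C *: (G *m zz))^t* = - 'i%C *: (G *m zz)^t*.
      by rewrite linearZ map_mxZ /=; congr (_ *: _); exact: conjc_i.
    have UE : U = c%:C *: G + ('i%C * d%:C) *: (G *m zz).
      by rewrite /U mulmxDr -!scalemxAr mulmx1.
    rewrite /unitary_channel Us iZ UE.
    rewrite !(mulmxDl, mulmxDr, mulmxBr, mulmxBl) -!(scalemxAl, scalemxAr) -/c -/d.
    move: (G *m rho *m G^t*) (G *m zz *m rho *m G^t*) (G *m rho *m (G *m zz)^t*)
      (G *m zz *m rho *m (G *m zz)^t*) => W0 W1 W2 W3.
    (* The square of ['i] is kept explicit because [ring] treats ['i] as an atom. *)
    have -> : (d ^+ 2)%:C = - ('i * 'i) * (d%:C * d%:C).
      by rewrite sqr_im opprK mul1r expr2 real_complexM.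
    rewrite expr2 !real_complexM; apply/matrixP => x y; rewrite !mxE.
    rewrite ?imaginaryE; ring.
  - rewrite (sum4E (fun j => _)) !(tnth_nth 0) /= /s -/c -/d !normrX !normrM; ring.
have s0 : 0 <= s by rewrite addr_ge0.
have AT (V : 'M[C]_(2 ^ 2)) : \tr (A^t* *m V^t*) = conjc (\tr (A *m V)).
  by rewrite mxtrace_mulC -map_mxM -trmx_mul /= trace_map_mx mxtrace_tr.
(* The product functional is [(4 * s)^2] on the channel and at most 16 in modulus on each pair of
   Gaussian factors. *)
have := tr_mul_sandwich A (A^t*) UE.
rewrite AT trAU => sE.
suff : ((4 * s) * (4 * s))%:C <= ((\sum_j `|q j|) * 16)%:C :> C.
  by rewrite lecR; nra.
have -> : ((4 * s) * (4 * s))%:C = `|(4 * s)%:C * conjc (4 * s)%:C| :> C.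
  rewrite normrM normcJ -normrM -rmorphM ger0_norm // lecR; nra.
rewrite sE; apply: le_trans (ler_norm_sum _ _ _) _.
rewrite rmorphM rmorph_sum mulr_suml; apply: ler_sum => j _.
have [gL gT] := gLT j.
rewrite !normrM normc_def /= expr0n addr0 sqrtr_sqr ler_wpM2l ?lecR //.
apply: (@le_trans _ _ (4 * 4)); last by rewrite real_complex_nat -natrM.
rewrite ler_pM ?trA_le // -(trmxCK (T j)) AT normcJ trA_le //.
exact: gaussian_adj.
Qed.
End Extent.

(** * Factorizations of the three gates *)

Section Factorizations.
Variable R : realType.
Local Notation C := R[i].

Lemma expiD (s t : R) : expi (s + t) = expi s * expi t.
Proof.
by apply/eqP; rewrite eq_complex /= cosD sinD eqxx; apply/eqP; rewrite addrC.
Qed.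

Lemma expi0 : expi 0 = 1 :> C.
Proof. by rewrite /expi cos0 sin0. Qed.

Lemma expi_unit (t : R) : expi t * conjc (expi t) = 1.
Proof.
apply/eqP; rewrite eq_complex /= -(cos2Dsin2 t); apply/andP; split; apply/eqP; ring.
Qed.

Lemma expi_factor (t : R) :
  expi t = (cos t)%:C + 'i * (sin t)%:C /\ expi (- t) = (cos t)%:C - 'i * (sin t)%:C.
Proof.
by split; apply/eqP; rewrite eq_complex /= ?cosN ?sinN; apply/andP; split; apply/eqP; ring.
Qed.

(** The projector on |1,1> is a quarter of 1 - Z *t I - I *t Z + Z *t Z. Exponentiating gives a
    phase, a rotation of both Majorana pairs, and a parity rotation. *)
Lemma Cgate_factor (theta : R) : exists2 G : 'M[C]_(2 ^ 2), gaussian 2 G &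
  Cgate theta = G *m zz_rotation (theta / 4).
Proof.
pose r := mx_rows [:: [:: expi (- (theta / 2)); 0; 0; 0]; [:: 0; 1; 0; 0];
                      [:: 0; 0; 1; 0]; [:: 0; 0; 0; expi (theta / 2)]] : 'M[C]_(2 ^ 2).
exists (expi (theta / 4) *: r).
  apply: gaussian_scale; first exact: expi_unit.
  have [h1 h2] := expi_factor (theta / 2).
  exact: gaussian_zrot (cos2Dsin2 _) h1 h2.
rewrite zz_rotationE -scalemxAl mul_mx_rows /mul_rows /mkseq /= !simp0 -!expiD.
entries4; rewrite !mxE /= ?mulr0n ?mulr1n ?simp0 // -?expiD.
- by rewrite -[LHS]expi0; congr expi; lra.
- by rewrite -[LHS]expi0; congr expi; lra.
- by rewrite -[LHS]expi0; congr expi; lra.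
- by congr expi; lra.
Qed.

(** SWAP and iSWAP differ by the phase i on the odd sector, which is a parity rotation up to a
    global phase. *)
Lemma SWAPgate_factor : exists2 G : 'M[C]_(2 ^ 2), gaussian 2 G &
  SWAPgate R = G *m zz_rotation (pi / 4).
Proof.
exists (expi (- (pi / 4)) *: mx_rows
    [:: [:: 1; 0; 0; 0]; [:: 0; 0; 'i%C; 0]; [:: 0; 'i%C; 0; 0]; [:: 0; 0; 0; 1]]).
  apply: gaussian_scale; [exact: expi_unit | exact: gaussian_iswap].
rewrite zz_rotationE -scalemxAl mul_mx_rows /mul_rows /mkseq /= !simp0.
have w1 : expi (- (pi / 4)) * expi (pi / 4) = 1 :> C.
  by rewrite -expiD addNr expi0.
have w2 : expi (- (pi / 4)) * ('i%C * expi (- (pi / 4))) = 1 :> C.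
  have iE : 'i%C = expi (pi / 2) :> C by rewrite /expi cos_pihalf sin_pihalf.
  by rewrite ?imaginaryE iE -!expiD -[RHS]expi0; congr expi; lra.
by entries4; rewrite /SWAPgate !big_ord_recl !big_ord0 !mxE /= ?mxE /= ?simp0 ?w1 ?w2 ?simp0.
Qed.

Lemma exp_coeff_im (u : R) k :
  (k`!%:R)^-1 * ('i * u%:C) ^+ k = cos_coeff u k +i* sin_coeff u k :> C.
Proof.
have E : ('i * u%:C) ^+ k =
    ((~~ odd k)%:R * (-1) ^+ k./2 * u ^+ k) +i* ((odd k)%:R * (-1) ^+ k.-1./2 * u ^+ k) :> C.
  rewrite exprMn_comm; last exact: mulrC.
  have -> : u%:C ^+ k = (u ^+ k)%:C by rewrite -rmorphXn.
  have -> : 'i ^+ k = ((~~ odd k)%:R * (-1) ^+ k./2) +i* ((odd k)%:R * (-1) ^+ k.-1./2) :> C.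
    rewrite -[in LHS](odd_double_half k) exprD -mul2n exprM sqr_i.
    have -> : (-1) ^+ k./2 = ((-1) ^+ k./2)%:C :> C.
      by elim: (k./2) => // n IHn; rewrite !exprS real_complexM -IHn; congr (_ * _); apply/eqP; rewrite eq_complex /= oppr0 !eqxx.
    case: (boolP (odd k)) => ok /=.
      (* The sine coefficients are indexed by [k.-1./2], which agrees with [k./2] for odd [k]. *)
      have -> : k.-1./2 = k./2 by case: k ok => //= k; rewrite uphalf_half => /negPf ->.
      by apply/eqP; rewrite eq_complex /=; apply/andP; split; apply/eqP; rewrite ?expr1; ring.
    by apply/eqP; rewrite eq_complex /=; apply/andP; split; apply/eqP; rewrite ?expr0; ring.
  by apply/eqP; rewrite eq_complex /=; apply/andP; split; apply/eqP; ring.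
rewrite E.
have -> : (k`!%:R)^-1 = ((k`!%:R)^-1)%:C :> C by rewrite fmorphV rmorph_nat.
by apply/eqP; rewrite eq_complex /= /cos_coeff /sin_coeff; apply/andP; split; apply/eqP; rewrite mul0r ?subr0 ?addr0 mulrC; reflexivity.
Qed.

Lemma mx_rows_diag_exp (T : pzSemiRingType) (x y : T) k : (mx_rows
   [:: [:: x; 0; 0; 0]; [:: 0; y; 0; 0]; [:: 0; 0; y; 0]; [:: 0; 0; 0; x]]) ^+ k = mx_rows
   [:: [:: x ^+ k; 0; 0; 0]; [:: 0; y ^+ k; 0; 0]; [:: 0; 0; y ^+ k; 0]; [:: 0; 0; 0; x ^+ k]].
Proof.
elim: k => [|k IHk]; first by rewrite expr0; entries4; rewrite !mxE /= ?expr0.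
by rewrite exprS IHk -[_ * _]/(_ *m _) mul_mx_rows /mul_rows /mkseq /= !simp0 -!exprS.
Qed.

(** The argument is a sequence rather than a base: off-diagonal entries of powers of a diagonal
    matrix form the zero sequence, unlike the powers of 0, which start with 1. *)
Definition expsum (f : nat -> C) : C :=
  limn (fun N => complex.Re (\sum_(0 <= k < N) (k`!%:R)^-1 * f k) : R) +i*
  limn (fun N => complex.Im (\sum_(0 <= k < N) (k`!%:R)^-1 * f k) : R).

Lemma expmxE (n : nat) (A : 'M[C]_n) i j :
  expmx A i j = expsum (fun k => (A ^+ k) i j).
Proof.
rewrite mxE.
have E N : expmx_partial A N i j = \sum_(0 <= k < N) (k`!%:R)^-1 * (A ^+ k) i j.
  by rewrite /expmx_partial summxE; apply: eq_bigr => k _; rewrite mxE.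
rewrite /expsum.
have -> : (fun N => complex.Re (expmx_partial A N i j) : R) =
    fun N => complex.Re (\sum_(0 <= k < N) (k`!%:R)^-1 * (A ^+ k) i j).
  by apply/funext => N; rewrite E.
have -> // : (fun N => complex.Im (expmx_partial A N i j) : R) =
    fun N => complex.Im (\sum_(0 <= k < N) (k`!%:R)^-1 * (A ^+ k) i j).
by apply/funext => N; rewrite E.
Qed.

Lemma expsum0 : expsum (fun=> 0) = 0.
Proof.
have E N : \sum_(0 <= k < N) (k`!%:R)^-1 * 0 = 0 :> C.
  by rewrite big1 // => k _; rewrite mulr0.
rewrite /expsum.
have -> : (fun N => complex.Re (\sum_(0 <= k < N) (k`!%:R)^-1 * 0 : C) : R) = fun=> 0.
  by apply/funext => N; rewrite E.
have -> : (fun N => complex.Im (\sum_(0 <= k < N) (k`!%:R)^-1 * 0 : C) : R) = fun=> 0.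
  by apply/funext => N; rewrite E.
by rewrite lim_cst.
Qed.

(** The real and imaginary partial sums are exactly the series whose limits define [cos] and
    [sin]. *)
Lemma expsum_im (v : R) : expsum (fun k => ('i * v%:C) ^+ k) = expi v.
Proof.
have E N : \sum_(0 <= k < N) (k`!%:R)^-1 * ('i * v%:C) ^+ k =
    series (cos_coeff v) N +i* series (sin_coeff v) N.
  rewrite /series /=; elim: N => [|N IHN]; first by rewrite !big_geq.
  by rewrite !big_nat_recr //= IHN exp_coeff_im.
rewrite /expsum.
have -> : (fun N => complex.Re (\sum_(0 <= k < N) (k`!%:R)^-1 * ('i * v%:C) ^+ k) : R)
    = series (cos_coeff v) by apply/funext => N; rewrite E.
have -> : (fun N => complex.Im (\sum_(0 <= k < N) (k`!%:R)^-1 * ('i * v%:C) ^+ k) : R)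
    = series (sin_coeff v) by apply/funext => N; rewrite E.
by rewrite /expi cos.unlock sin.unlock.
Qed.

Lemma expmx_rows_diag (x y : C) :
  let ex := expsum (fun k => x ^+ k) in let ey := expsum (fun k => y ^+ k) in
  expmx (mx_rows [:: [:: x; 0; 0; 0]; [:: 0; y; 0; 0]; [:: 0; 0; y; 0]; [:: 0; 0; 0; x]])
  = mx_rows [:: [:: ex; 0; 0; 0]; [:: 0; ey; 0; 0]; [:: 0; 0; ey; 0]; [:: 0; 0; 0; ex]].
Proof.
move=> ex ey; pose r k := [:: [:: x ^+ k; 0; 0; 0]; [:: 0; y ^+ k; 0; 0];
                             [:: 0; 0; y ^+ k; 0]; [:: 0; 0; 0; x ^+ k]].
apply/matrixP => i j; rewrite expmxE mxE.
have -> : (fun k => fun_of_matrix ((mx_rows [:: [:: x; 0; 0; 0]; [:: 0; y; 0; 0];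
     [:: 0; 0; y; 0]; [:: 0; 0; 0; x]]) ^+ k) i j) = fun k => nth 0 (nth [::] (r k) i) j.
  by apply/funext => k; rewrite mx_rows_diag_exp mxE.
by rewrite {}/r; move: i j; do 2! apply: ord4_ind; rewrite /= ?expsum0.
Qed.

Lemma RZZgate_factor (theta : R) : RZZgate theta = zz_rotation (- (theta / 2)).
Proof.
rewrite /RZZgate pauliZZ; set u := - (theta / 2).
have -> : (- 'i * theta%:C / 2%:R) *: zz R = mx_rows
   [:: [:: 'i * u%:C; 0; 0; 0]; [:: 0; 'i * (- u)%:C; 0; 0];
       [:: 0; 0; 'i * (- u)%:C; 0]; [:: 0; 0; 0; 'i * u%:C]].
  have E : - 'i * theta%:C / 2%:R = 'i * u%:C :> C.
    have -> : u%:C = - (theta%:C * 2%:R^-1) :> C.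
      by rewrite /u rmorphN /= real_complexM fmorphV rmorph_nat.
    by rewrite ?imaginaryE; ring.
  have uN : (- u)%:C = - u%:C :> C by exact: rmorphN.
  by rewrite uN; clearbody u; entries4; rewrite !mxE /= E ?simp0 // ?imaginaryE; ring.
by rewrite expmx_rows_diag !expsum_im zz_rotationE.
Qed.
End Factorizations.

Theorem mainTheorem14 (R : realType) :
  (forall theta : R, 0 <= theta -> theta < 2 * pi ->
     fermionic_nonlinearity 2 (unitary_channel (Cgate theta))
       = unitary_extent 2 (Cgate theta) /\
     fermionic_nonlinearity 2 (unitary_channel (Cgate theta))
       = 1 + `|sin (theta / 2)| /\
     fermionic_nonlinearity 2 (unitary_channel (RZZgate theta))
       = unitary_extent 2 (RZZgate theta) /\
     fermionic_nonlinearity 2 (unitary_channel (RZZgate theta))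
       = 1 + `|sin theta|) /\
  fermionic_nonlinearity 2 (unitary_channel (SWAPgate R))
    = unitary_extent 2 (SWAPgate R) /\
  fermionic_nonlinearity 2 (unitary_channel (SWAPgate R)) = 2.
Proof.
split=> [theta _ _|].
  have [G gG ->] := Cgate_factor theta.
  rewrite (nonlinearity_zz_rotation _ gG) (unitary_extent_zz_rotation _ gG).
  have -> : 2 * (theta / 4) = theta / 2 :> R by lra.
  (* Here the Gaussian factor is the identity. *)
  rewrite RZZgate_factor -[zz_rotation _]mul1mx.
  have g1 := gaussian1 R 2.
  rewrite (nonlinearity_zz_rotation _ g1) (unitary_extent_zz_rotation _ g1).
  have -> : 2 * - (theta / 2) = - theta :> R by lra.
  by rewrite sinN normrN.
have [G gG ->] := SWAPgate_factor R.
rewrite (nonlinearity_zz_rotation _ gG) (unitary_extent_zz_rotation _ gG).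
have -> : 2 * (pi / 4) = pi / 2 :> R by lra.
by rewrite sin_pihalf normr1.
Qed.
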